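(* Let $k$ be a positive integer and let $\varphi$ be a graded modal formula of modal depth at most $k$ in a modal vocabulary $\sigma$. The following are equivalent: (1) $\varphi$ is preserved under homomorphisms between pointed Kripke structures; (2) $\varphi$ is logically equivalent (over all pointed Kripke structures) to an existential positive modal formula of modal depth at most $k$.
   Context: A modal vocabulary is a relational vocabulary all of whose relation symbols have arity at most 2; its structures are Kripke structures, and a pointed Kripke structure is a pair $(\mathcal{A},a)$ with $a\in\mathcal{A}$. Each unary symbol $P$ gives a propositional variable $p$ (true at $a$ iff $a\in P^{\mathcal{A}}$) and each binary symbol $R$ gives modalities $\Diamond_R,\Box_R$ with accessibility relation $R^{\mathcal{A}}$. Graded modal formulas may additionally use graded modalities $\Diamond_R^n$, $\Box_R^n$ ($n\ge 0$), where $\mathcal{A},a\models\Diamond_R^n\psi$ iff at least $n$ $R$-successors of $a$ satisfy $\psi$, and $\Box_R^n\psi=\neg\Diamond_R^n\neg\psi$. The modal depth of a formula is the maximum number of nested modalities (graded or not). An existential positive modal formula is a (non-graded) modal formula built using only $\vee$, $\wedge$ and diamond modalities $\Diamond_R$. A homomorphism of pointed Kripke structures $(\mathcal{A},a)\to(\mathcal{B},b)$ is a $\sigma$-homomorphism $h$ with $h(a)=b$; $\varphi$ is preserved under homomorphisms if $\mathcal{A},a\models\varphi$ and such an $h$ exists imply $\mathcal{B},b\models\varphi$. *)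

(* Defs.v *)
From Stdlib Require Import List Arith.
Import ListNotations.

Set Implicit Arguments.
Unset Strict Implicit.

(** Relation symbols have positive arity, so a vocabulary with arities at most 2
    is a pair of (arbitrary, possibly infinite) families of unary and binary
    symbols. *)
Record vocabulary : Type := Vocabulary {
  unary : Type;
  binary : Type
}.

Record kripke (sigma : vocabulary) : Type := Kripke {
  carrier :> Type;
  val : unary sigma -> carrier -> Prop;
  acc : binary sigma -> carrier -> carrier -> Prop
}.

Definition is_hom (sigma : vocabulary) (A B : kripke sigma) (h : A -> B) : Prop :=
  (forall (P : unary sigma) (x : A), val P x -> val P (h x)) /\
  (forall (R : binary sigma) (x y : A), acc R x y -> acc R (h x) (h y)).

Definition pointed_hom (sigma : vocabulary) (A : kripke sigma) (a : A)
    (B : kripke sigma) (b : B) (h : A -> B) : Prop :=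
  is_hom h /\ h a = b.

(** Graded modal formulas. [Top] and [Bot] are the empty conjunction and the
    empty disjunction. *)
Inductive formula (sigma : vocabulary) : Type :=
| Var  (P : unary sigma)
| Top
| Bot
| Neg  (f : formula sigma)
| And  (f g : formula sigma)
| Or   (f g : formula sigma)
| Dia  (R : binary sigma) (f : formula sigma)
| Box  (R : binary sigma) (f : formula sigma)
| GDia (R : binary sigma) (n : nat) (f : formula sigma)
| GBox (R : binary sigma) (n : nat) (f : formula sigma).

Arguments Top {sigma}.
Arguments Bot {sigma}.

Definition at_least (T : Type) (n : nat) (Q : T -> Prop) : Prop :=
  exists s : list T, NoDup s /\ length s = n /\ forall x, In x s -> Q x.

Fixpoint sat (sigma : vocabulary) (A : kripke sigma) (a : A)
    (f : formula sigma) {struct f} : Prop :=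
  match f with
  | Var P => val P a
  | Top => True
  | Bot => False
  | Neg g => ~ sat a g
  | And g1 g2 => sat a g1 /\ sat a g2
  | Or g1 g2 => sat a g1 \/ sat a g2
  | Dia R g => exists y : A, acc R a y /\ sat y g
  | Box R g => forall y : A, acc R a y -> sat y g
  | GDia R n g => at_least n (fun y : A => acc R a y /\ sat y g)
  | GBox R n g => ~ at_least n (fun y : A => acc R a y /\ ~ sat y g)
  end.

Fixpoint depth (sigma : vocabulary) (f : formula sigma) : nat :=
  match f with
  | Var _ | Top | Bot => 0
  | Neg g => depth g
  | And g1 g2 | Or g1 g2 => Nat.max (depth g1) (depth g2)
  | Dia _ g | Box _ g | GDia _ _ g | GBox _ _ g => S (depth g)
  end.

Fixpoint existential_positive (sigma : vocabulary) (f : formula sigma) : Prop :=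
  match f with
  | Var _ | Top | Bot => True
  | And g1 g2 | Or g1 g2 => existential_positive g1 /\ existential_positive g2
  | Dia _ g => existential_positive g
  | Neg _ | Box _ _ | GDia _ _ _ | GBox _ _ _ => False
  end.

Definition preserved_under_homs (sigma : vocabulary) (f : formula sigma) : Prop :=
  forall (A : kripke sigma) (a : A) (B : kripke sigma) (b : B),
    sat a f -> (exists h : A -> B, pointed_hom a b h) -> sat b f.

Definition logically_equivalent (sigma : vocabulary) (f g : formula sigma) : Prop :=
  forall (A : kripke sigma) (a : A), sat a f <-> sat a g.

(* Main.v *)
(** If [phi] is preserved under homomorphisms, it is preserved by the preorder
    "every existential positive formula of depth at most [k] true at [(A,a)] is
    true at [(B,b)]": unravel [A] from [a] into a tree of height [k]. Graded
    formulas of depth at most [k] cannot tell the tree from [A], and the preorder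
    provides a step-by-step choice of a homomorphism from the tree to [B]. Over the
    finitely many symbols of [phi], existential positive formulas of depth at most
    [k] are generated by a finite list, so [phi] is a finite disjunction of finite
    conjunctions from that list. *)

From Stdlib Require Import List Arith Lia Classical ClassicalEpsilon.
Require Import Defs.
Import ListNotations.

Set Implicit Arguments.
Unset Strict Implicit.

(** * Counting and finite lists *)

Lemma at_least_image (T U : Type) (g : T -> U) (n : nat)
    (Q : T -> Prop) (Q' : U -> Prop) :
  (forall x, Q x -> Q' (g x)) ->
  (forall x y, Q x -> Q y -> g x = g y -> x = y) ->
  at_least n Q -> at_least n Q'.
Proof.
  intros HQ Hinj [s [Hnd [Hlen Hs]]].
  exists (map g s); split; [|split].
  - apply NoDup_map_NoDup_ForallPairs; [|exact Hnd].
    intros x y Hx Hy; apply Hinj; auto.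
  - now rewrite length_map.
  - intros u Hu; apply in_map_iff in Hu as [x [<- Hx]]; auto.
Qed.

Fixpoint sublists (T : Type) (l : list T) : list (list T) :=
  match l with
  | [] => [[]]
  | x :: l' => map (cons x) (sublists l') ++ sublists l'
  end.

Lemma in_sublists_incl (T : Type) (l s : list T) : In s (sublists l) -> incl s l.
Proof.
  revert s; induction l as [|x l IH]; simpl; intros s Hs.
  - destruct Hs as [<-|[]]; apply incl_refl.
  - apply in_app_or in Hs as [Hs|Hs].
    + apply in_map_iff in Hs as [s' [<- Hs']].
      intros y [->|Hy]; [now left|right; now apply (IH s')].
    + intros y Hy; right; now apply (IH s).
Qed.

(** A substitute for [filter]: [Q] need not be decidable, so excluded middle settles each element in
    turn. *)
Lemma sublist_comprehension (T : Type) (l : list T) (Q : T -> Prop) :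
  exists s, In s (sublists l) /\ forall x, In x s <-> In x l /\ Q x.
Proof.
  induction l as [|x l [s [Hs HQ]]]; simpl.
  - exists []; split; [now left|simpl; tauto].
  - destruct (classic (Q x)) as [Hx|Hx].
    + exists (x :: s); split.
      * apply in_or_app; left; now apply in_map.
      * intros y; simpl; rewrite HQ; intuition congruence.
    + exists s; split.
      * apply in_or_app; now right.
      * intros y; rewrite HQ; intuition congruence.
Qed.

(** * Finite conjunctions and disjunctions of existential positive formulas *)

Definition conj_list (sigma : vocabulary) (l : list (formula sigma)) : formula sigma :=
  fold_right (@And sigma) Top l.

Definition disj_list (sigma : vocabulary) (l : list (formula sigma)) : formula sigma :=
  fold_right (@Or sigma) Bot l.

Lemma sat_conj_list (sigma : vocabulary) (A : kripke sigma) (a : A)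
    (l : list (formula sigma)) :
  sat a (conj_list l) <-> forall f, In f l -> sat a f.
Proof.
  induction l as [|f l IH]; simpl; [tauto|].
  rewrite IH; firstorder congruence.
Qed.

Lemma sat_disj_list (sigma : vocabulary) (A : kripke sigma) (a : A)
    (l : list (formula sigma)) :
  sat a (disj_list l) <-> exists f, In f l /\ sat a f.
Proof.
  induction l as [|f l IH]; simpl; [firstorder|].
  rewrite IH; firstorder congruence.
Qed.

Definition ep_upto (sigma : vocabulary) (n : nat) (f : formula sigma) : Prop :=
  existential_positive f /\ depth f <= n.

Lemma ep_upto_conj_list (sigma : vocabulary) (n : nat) (l : list (formula sigma)) :
  (forall f, In f l -> ep_upto n f) -> ep_upto n (conj_list l).
Proof.
  unfold ep_upto; induction l as [|f l IH]; simpl; intros H; [split; [exact I|lia]|].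
  destruct (H f (or_introl eq_refl)), IH; [intros; apply H; now right|].
  split; [now split|lia].
Qed.

Lemma ep_upto_disj_list (sigma : vocabulary) (n : nat) (l : list (formula sigma)) :
  (forall f, In f l -> ep_upto n f) -> ep_upto n (disj_list l).
Proof.
  unfold ep_upto; induction l as [|f l IH]; simpl; intros H; [split; [exact I|lia]|].
  destruct (H f (or_introl eq_refl)), IH; [intros; apply H; now right|].
  split; [now split|lia].
Qed.

Lemma existential_positive_preserved (sigma : vocabulary) (f : formula sigma) :
  existential_positive f -> preserved_under_homs f.
Proof.
  intros Hf A a B b Ha [h [[Hval Hacc] <-]].
  revert a Ha; induction f; simpl in *; intros a Ha; try tauto.
  - now apply Hval.
  - split; [apply IHf1|apply IHf2]; tauto.
  - destruct Ha as [Ha|Ha]; [left; apply IHf1|right; apply IHf2]; tauto.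
  - destruct Ha as [y [Hy Hs]]; exists (h y); auto.
Qed.

(** * A finite generating list and the preorder it induces *)

(** The existential positive formulas of depth at most [n] over the symbols
    [LP], [LR] that are not themselves conjunctions or disjunctions, up to
    equivalence and up to distributing diamonds over disjunctions. *)
Fixpoint basics (sigma : vocabulary) (LP : list (unary sigma)) (LR : list (binary sigma))
    (n : nat) : list (formula sigma) :=
  map (@Var sigma) LP ++
  match n with
  | 0 => []
  | S n' => flat_map (fun R => map (fun s => Dia R (conj_list s))
                                 (sublists (basics LP LR n'))) LR
  end.

Lemma var_in_basics (sigma : vocabulary) (LP : list (unary sigma))
    (LR : list (binary sigma)) (n : nat) (P : unary sigma) :
  In P LP -> In (Var P) (basics LP LR n).
Proof.
  intros HP; destruct n; apply in_or_app; left; now apply in_map.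
Qed.

Lemma dia_in_basics (sigma : vocabulary) (LP : list (unary sigma))
    (LR : list (binary sigma)) (n : nat) (R : binary sigma) (s : list (formula sigma)) :
  In R LR -> In s (sublists (basics LP LR n)) ->
  In (Dia R (conj_list s)) (basics LP LR (S n)).
Proof.
  intros HR Hs; apply in_or_app; right; apply in_flat_map.
  exists R; split; [exact HR|].
  apply in_map_iff; now exists s.
Qed.

Lemma basics_ep_upto (sigma : vocabulary) (LP : list (unary sigma))
    (LR : list (binary sigma)) (n : nat) (f : formula sigma) :
  In f (basics LP LR n) -> ep_upto n f.
Proof.
  revert f; induction n as [|n IH]; intros f Hf; apply in_app_or in Hf as [Hf|Hf];
    try (apply in_map_iff in Hf as [P [<- _]]; split; simpl; [exact I|lia]).
  - destruct Hf.
  - apply in_flat_map in Hf as [R [_ Hf]].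
    apply in_map_iff in Hf as [s [<- Hs]].
    destruct (@ep_upto_conj_list sigma n s) as [Hep Hd].
    + intros g Hg; apply IH; now apply (in_sublists_incl Hs).
    + split; simpl; [exact Hep|lia].
Qed.

Definition basics_le (sigma : vocabulary) (LP : list (unary sigma))
    (LR : list (binary sigma)) (n : nat) (A : kripke sigma) (a : A)
    (B : kripke sigma) (b : B) : Prop :=
  forall f, In f (basics LP LR n) -> sat a f -> sat b f.

(** A single diamond over the conjunction of all level-[n] basics true at [x] is itself a basic one
    level up. It therefore transfers to [b], and its witness there satisfies all these basics at
    once. *)
Lemma basics_le_step (sigma : vocabulary) (LP : list (unary sigma))
    (LR : list (binary sigma)) (n : nat) (A : kripke sigma) (a x : A)
    (B : kripke sigma) (b : B) (R : binary sigma) :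
  basics_le LP LR (S n) a b -> In R LR -> acc R a x ->
  exists y : B, acc R b y /\ basics_le LP LR n x y.
Proof.
  intros Hle HR Hx.
  destruct (sublist_comprehension (basics LP LR n) (fun f => sat x f)) as [s [Hs HQ]].
  destruct (Hle (Dia R (conj_list s))) as [y [Hy Hsat]].
  - now apply dia_in_basics.
  - exists x; split; [exact Hx|].
    apply sat_conj_list; intros f Hf; now apply HQ.
  - exists y; split; [exact Hy|].
    intros f Hf Hxf; apply (proj1 (sat_conj_list y s) Hsat), HQ; now split.
Qed.

(** * Unravelling into a tree of bounded height *)

(** Paths are stored last step first. The structure below has all lists as
    elements; those that are not paths of length at most [k] from [a] are
    isolated. *)
Definition tip (sigma : vocabulary) (A : kripke sigma) (a : A)
    (p : list (binary sigma * A)) : A :=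
  match p with
  | [] => a
  | (_, y) :: _ => y
  end.

Fixpoint path (sigma : vocabulary) (LR : list (binary sigma)) (k : nat)
    (A : kripke sigma) (a : A) (p : list (binary sigma * A)) : Prop :=
  match p with
  | [] => True
  | (R, y) :: p' => In R LR /\ acc R (tip a p') y /\ length p' < k /\ path LR k a p'
  end.

(** Symbols outside [LP] and [LR] hold nowhere, so a homomorphism out of the tree has only finitely
    many symbols to respect. *)
Definition unravel (sigma : vocabulary) (LP : list (unary sigma))
    (LR : list (binary sigma)) (k : nat) (A : kripke sigma) (a : A) : kripke sigma :=
  {| carrier := list (binary sigma * A);
     val := fun P p => In P LP /\ path LR k a p /\ val P (tip a p);
     acc := fun R p q => exists y, q = (R, y) :: p /\ path LR k a q |}.

Fixpoint unary_symbols (sigma : vocabulary) (f : formula sigma) : list (unary sigma) :=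
  match f with
  | Var P => [P]
  | Top | Bot => []
  | And g1 g2 | Or g1 g2 => unary_symbols g1 ++ unary_symbols g2
  | Neg g | Dia _ g | Box _ g | GDia _ _ g | GBox _ _ g => unary_symbols g
  end.

Fixpoint binary_symbols (sigma : vocabulary) (f : formula sigma) : list (binary sigma) :=
  match f with
  | Var _ | Top | Bot => []
  | And g1 g2 | Or g1 g2 => binary_symbols g1 ++ binary_symbols g2
  | Neg g => binary_symbols g
  | Dia R g | Box R g | GDia R _ g | GBox R _ g => R :: binary_symbols g
  end.

(** The map sending [y] to [(R, y) :: p] is a bijection from the [R]-successors of the tip onto
    those of [p], with inverse [tip a]; hence counts agree. The bound on [length p] leaves room for
    one more step. *)
Lemma unravel_at_least (sigma : vocabulary) (LP : list (unary sigma))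
    (LR : list (binary sigma)) (k : nat) (A : kripke sigma) (a : A)
    (p : unravel LP LR k a) (R : binary sigma) (n : nat)
    (Q : A -> Prop) (Q' : unravel LP LR k a -> Prop) :
  path LR k a p -> length p < k -> In R LR ->
  (forall y, path LR k a ((R, y) :: p) -> (Q' ((R, y) :: p) <-> Q y)) ->
  at_least n (fun q : unravel LP LR k a => acc R p q /\ Q' q) <->
  at_least n (fun y : A => acc R (tip a p) y /\ Q y).
Proof.
  intros Hp Hlen HR HQ; split.
  - apply (@at_least_image (unravel LP LR k a) A (tip a)).
    + intros q [[y [-> Hq]] HQ']; split; [apply Hq|now apply HQ].
    + intros q q' [[y [-> _]] _] [[y' [-> _]] _]; simpl; congruence.
  - apply (@at_least_image A (unravel LP LR k a) (fun y => (R, y) :: p)).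
    + intros y [Hy HQy].
      assert (Hq : path LR k a ((R, y) :: p)) by (simpl; tauto).
      split; [now exists y|now apply HQ].
    + intros y y' _ _ E; congruence.
Qed.

(** Together with [forall_at_least], this turns plain diamonds and boxes into graded ones with
    threshold 1, so that [unravel_at_least] covers all four modalities. *)
Lemma at_least_one (T : Type) (Q : T -> Prop) : at_least 1 Q <-> exists x, Q x.
Proof.
  split.
  - intros [[|x s] [_ [Hlen Hs]]]; [discriminate|].
    exists x; apply Hs; now left.
  - intros [x Hx]; exists [x]; split; [|split; [reflexivity|]].
    + constructor; [easy|constructor].
    + intros y [<-|[]]; exact Hx.
Qed.

Lemma forall_at_least (T : Type) (Q Q' : T -> Prop) :
  (forall x, Q x -> Q' x) <-> ~ at_least 1 (fun x => Q x /\ ~ Q' x).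
Proof.
  rewrite at_least_one; split.
  - intros H [x [Hx Hx']]; auto.
  - intros H x Hx; apply NNPP; intros Hx'; apply H; now exists x.
Qed.

(** Each modality lengthens the path by one and lowers the remaining depth by one, which keeps the
    sum within [k]. *)
Lemma sat_unravel (sigma : vocabulary) (LP : list (unary sigma))
    (LR : list (binary sigma)) (k : nat) (A : kripke sigma) (a : A)
    (f : formula sigma) (p : unravel LP LR k a) :
  incl (unary_symbols f) LP -> incl (binary_symbols f) LR ->
  path LR k a p -> length p + depth f <= k ->
  sat p f <-> sat (tip a p) f.
Proof.
  revert p; induction f; intros p HP HR Hp Hlen; cbn in HP, HR, Hlen;
    try (apply incl_app_inv in HP as [HP1 HP2]; apply incl_app_inv in HR as [HR1 HR2];
         simpl; rewrite IHf1, IHf2 by (auto; lia); tauto);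
    try (apply incl_cons_inv in HR as [HR1 HR2];
         assert (Hsucc : forall y, path LR k a ((R, y) :: p) ->
                   (@sat sigma (unravel LP LR k a) ((R, y) :: p) f <-> sat y f))
           by (intros y Hy; apply IHf; simpl length; auto; lia)).
  - split; [now intros [_ [_ H]]|intros H; repeat split; auto].
    apply HP; now left.
  - reflexivity.
  - reflexivity.
  - simpl; rewrite IHf by (auto; lia); tauto.
  - cbn [sat]; rewrite <- !at_least_one.
    apply unravel_at_least; auto; lia.
  - cbn [sat]; rewrite !forall_at_least.
    apply not_iff_compat, unravel_at_least; auto; [lia|].
    intros y Hy; apply not_iff_compat; auto.
  - apply unravel_at_least; auto; lia.
  - apply not_iff_compat, unravel_at_least; auto; [lia|].
    intros y Hy; apply not_iff_compat; auto.
Qed.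

(** * The homomorphism from the tree *)

(** [epsilon] makes the successive choices into a total function. On lists that are not paths its
    value is arbitrary, which is harmless since those points are isolated. *)
Fixpoint follow (sigma : vocabulary) (LP : list (unary sigma))
    (LR : list (binary sigma)) (k : nat) (A B : kripke sigma) (b : B)
    (p : list (binary sigma * A)) : B :=
  match p with
  | [] => b
  | (R, x) :: p' =>
      epsilon (inhabits b) (fun y =>
        acc R (follow LP LR k b p') y /\ basics_le LP LR (k - S (length p')) x y)
  end.

Lemma follow_invariant (sigma : vocabulary) (LP : list (unary sigma))
    (LR : list (binary sigma)) (k : nat) (A : kripke sigma) (a : A)
    (B : kripke sigma) (b : B) (p : list (binary sigma * A)) :
  basics_le LP LR k a b -> path LR k a p ->
  basics_le LP LR (k - length p) (tip a p) (follow LP LR k b p) /\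
  match p with
  | [] => True
  | (R, _) :: p' => acc R (follow LP LR k b p') (follow LP LR k b p)
  end.
Proof.
  intros Hab; induction p as [|[R x] p IH]; intros Hp.
  - simpl; rewrite Nat.sub_0_r; auto.
  - destruct Hp as [HR [Hx [Hlen Hp]]]; destruct (IH Hp) as [Hle _].
    (* Subtraction is truncated; [length p < k] is what makes the remaining level a successor. *)
    replace (k - length p) with (S (k - S (length p))) in Hle by lia.
    apply and_comm.
    exact (epsilon_spec (inhabits b) _ (basics_le_step Hle HR Hx)).
Qed.

Lemma follow_hom (sigma : vocabulary) (LP : list (unary sigma))
    (LR : list (binary sigma)) (k : nat) (A : kripke sigma) (a : A)
    (B : kripke sigma) (b : B) :
  basics_le LP LR k a b ->
  @pointed_hom sigma (unravel LP LR k a) [] B b (follow LP LR k b).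
Proof.
  intros Hab; split; [split|reflexivity].
  - intros P p [HP [Hp Hval]].
    apply (proj1 (follow_invariant Hab Hp) (Var P)); [now apply var_in_basics|exact Hval].
  - intros R p q [y [-> Hq]]; exact (proj2 (follow_invariant Hab Hq)).
Qed.

(** * From preservation to a finite disjunction *)

Lemma preserved_under_basics_le (sigma : vocabulary) (k : nat) (phi : formula sigma)
    (A : kripke sigma) (a : A) (B : kripke sigma) (b : B) :
  depth phi <= k -> preserved_under_homs phi ->
  basics_le (unary_symbols phi) (binary_symbols phi) k a b ->
  sat a phi -> sat b phi.
Proof.
  intros Hd Hpres Hle Ha.
  apply (Hpres (unravel (unary_symbols phi) (binary_symbols phi) k a) [] B b).
  - apply sat_unravel; simpl; auto using incl_refl.
  - eexists; apply follow_hom, Hle.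
Qed.

Theorem theorem4p9 (sigma : vocabulary) (k : nat) (hk : 0 < k)
    (phi : formula sigma) (hphi : depth phi <= k) :
  preserved_under_homs phi <->
  exists psi : formula sigma,
    existential_positive psi /\ depth psi <= k /\ logically_equivalent phi psi.
Proof.
  split.
  - intros Hpres.
    set (L := basics (unary_symbols phi) (binary_symbols phi) k).
    (* The models of [phi] are unbounded in number, but only finitely many sublists of [L] exist.
       [D] keeps those containing every basic true at some model of [phi]. *)
    destruct (sublist_comprehension (sublists L)
      (fun s => exists (A : kripke sigma) (a : A), sat a phi /\
                forall f, In f L -> sat a f -> In f s)) as [D [_ HD]].
    exists (disj_list (map (@conj_list sigma) D)).
    apply and_assoc; split.
    + apply ep_upto_disj_list; intros g Hg.
      apply in_map_iff in Hg as [s [<- Hs]]; apply HD in Hs as [Hs _].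
      apply ep_upto_conj_list; intros f Hf.
      apply (@basics_ep_upto sigma (unary_symbols phi) (binary_symbols phi)).
      now apply (in_sublists_incl Hs).
    + intros B b; rewrite sat_disj_list; split.
      * intros Hb.
        (* The disjunct is the conjunction of all basics true at [b], with [b] itself as the model
           justifying membership in [D]. *)
        destruct (sublist_comprehension L (fun f => sat b f)) as [s [Hs HQ]].
        exists (conj_list s); split.
        -- apply in_map, HD; split; [exact Hs|].
           exists B, b; split; [exact Hb|]; intros f Hf Hbf; now apply HQ.
        -- apply sat_conj_list; intros f Hf; now apply HQ.
      * intros [g [Hg Hb]].
        apply in_map_iff in Hg as [s [<- Hs]].
        apply HD in Hs as [_ [A [a [Ha Hs]]]].
        (* Every basic true at the model [a] behind [s] is a conjunct of [s], hence true at [b]. *)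
        apply (@preserved_under_basics_le sigma k phi A a B b); auto.
        intros f Hf Haf; apply (proj1 (sat_conj_list b s) Hb); auto.
  - intros [psi [Hep [_ Heq]]] A a B b Ha Hh.
    apply Heq; apply Heq in Ha.
    exact (existential_positive_preserved Hep Ha Hh).
Qed.
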